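(* Let $G$ be the graph on vertex set $\{0,1,\dots,9\}$ with the 17 edges $$\{0,1\},\{0,2\},\{0,3\},\{0,5\},\{1,5\},\{1,7\},\{2,3\},\{2,4\},\{2,6\},\{2,9\},\{3,4\},\{3,5\},\{3,6\},\{4,9\},\{5,7\},\{5,8\},\{6,9\},$$ and let $H$ be the graph on vertex set $\{0,1,\dots,9\}$ with the 16 edges $$\{0,1\},\{0,2\},\{0,3\},\{0,5\},\{1,5\},\{1,7\},\{2,3\},\{2,4\},\{2,5\},\{2,6\},\{2,9\},\{3,8\},\{4,9\},\{5,8\},\{6,9\},\{7,8\}.$$ Then for any finite connected graph $K$, any vertex $v \in V(K)$, and any $u \in \{0,1\}$, the graphs $GK(u,v)$ and $HK(u,v)$ are distance cospectral.
   Context: All graphs are finite, simple and connected. The distance matrix $D$ of a connected graph has rows and columns indexed by the vertices, with $(i,j)$ entry equal to the length of a shortest path between $i$ and $j$. Two connected graphs are distance cospectral if their distance matrices have the same multiset of eigenvalues. For graphs $G, K$ and vertices $u \in V(G)$, $v\in V(K)$, the graph $GK(u,v)$ is obtained from the disjoint union $G \cup K$ by identifying the vertices $u$ and $v$ into a single vertex. Similarly $HK(u,v)$ is obtained from $H\cup K$ by identifying $u \in V(H)$ with $v$. *)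

(* Defs.v *)
From HB Require Import structures.
From mathcomp Require Import all_boot all_order all_algebra all_field.
Set Implicit Arguments.
Unset Strict Implicit.
Unset Printing Implicit Defensive.
Import GRing.Theory.
Local Open Scope quotient_scope.

Record cgraph := CGraph {
  vertex :> finType;
  adj : rel vertex;
  adj_sym : symmetric adj;
  adj_irr : irreflexive adj;
  adj_connected : forall x y, connect adj x y
}.

Section Distance.
Variable G : cgraph.

Definition path_of_length (x y : G) (n : nat) : bool :=
  [exists p : n.-tuple G,
    [&& path (@adj G) x p, last x p == y & uniq (x :: p)]].

Lemma ex_path (x y : G) : exists n, path_of_length x y n.
Proof.
have /connectP[p xp ->] := adj_connected x y.
case/shortenP: xp => q xq uq _; exists (size q).
by apply/existsP; exists (in_tuple q); rewrite xq uq eqxx.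
Qed.

Definition dist (x y : G) : nat := ex_minn (ex_path x y).

Definition distance_mx : 'M[algC]_#|{: G}| :=
  (\matrix_(i, j) (dist (enum_val i) (enum_val j))%:R)%R.

End Distance.

(* The eigenvalues of A, each listed with its algebraic multiplicity; the
   order of the list is irrelevant as spectra are compared up to perm_eq. *)
Definition spectrum n (A : 'M[algC]_n) : seq algC :=
  sval (closed_field_poly_normal (char_poly A)).

Lemma char_poly_spectrum n (A : 'M[algC]_n) :
  char_poly A = (\prod_(z <- spectrum A) ('X - z%:P))%R.
Proof.
rewrite /spectrum; case: closed_field_poly_normal => s /= {1}->.
by rewrite (monicP (char_poly_monic A)) scale1r.
Qed.

Lemma mem_spectrum n (A : 'M[algC]_n) a : (a \in spectrum A) = eigenvalue A a.
Proof. by rewrite eigenvalue_root_char char_poly_spectrum root_prod_XsubC. Qed.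

Definition distance_cospectral (G H : cgraph) : Prop :=
  perm_eq (spectrum (distance_mx G)) (spectrum (distance_mx H)).

Section Coalescence.
Variables (G K : cgraph) (u : G) (v : K).

Definition union_adj : rel (G + K) := fun x y =>
  match x, y with
  | inl a, inl b => adj a b
  | inr a, inr b => adj a b
  | _, _ => false
  end.

Definition glued (x : G + K) : bool := (x == inl u) || (x == inr v).

Definition glue : rel (G + K) := fun x y => (x == y) || glued x && glued y.

Lemma glue_is_equiv : equiv_class_of glue.
Proof.
split=> [x|x y|y x z]; rewrite /glue ?eqxx //.
  by rewrite eq_sym andbC.
case/predU1P=> [->|/andP[gx gy]] //.
case/predU1P=> [<-|/andP[_ gz]]; first by rewrite gx gy orbT.
by rewrite gx gz orbT.
Qed.

Canonical glue_equiv := EquivRelPack glue_is_equiv.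

Definition coal_vertex := {eq_quot glue}.
HB.instance Definition _ : EqQuotient _ glue coal_vertex :=
  EqQuotient.on coal_vertex.
HB.instance Definition _ := Choice.on coal_vertex.
HB.instance Definition _ := Finite.copy coal_vertex
  (can_type (@EquivQuot.ereprK _ _ _ _ _ (defaultEncModRel glue))).

Definition coal_adj : rel coal_vertex := fun x y =>
  [exists a : G + K, [exists b : G + K,
    [&& \pi_coal_vertex a == x, \pi_coal_vertex b == y & union_adj a b]]].

Lemma coal_sym : symmetric coal_adj.
Proof.
have sub x y : coal_adj x y -> coal_adj y x.
  case/existsP=> a /existsP[b /and3P[ax bx ab]].
  apply/existsP; exists b; apply/existsP; exists a; rewrite ax bx /=.
  by case: a b ab {ax bx} => a [] b //=; rewrite adj_sym.
by move=> x y; apply/idP/idP; apply: sub.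
Qed.

Lemma coal_irr : irreflexive coal_adj.
Proof.
move=> x; apply/negbTE/negP=> /existsP[a /existsP[b /and3P[/eqP<- /eqP ba ab]]].
move/eqmodP: ba ab; rewrite /= /glue /glued.
case/predU1P=> [->|]; first by case: a => a /=; rewrite adj_irr.
by case: a b => a [] b //=; rewrite ?orbF ?orFb => /andP[/eqP[->] /eqP[->]];
  rewrite adj_irr.
Qed.

Lemma coal_connected x y : connect coal_adj x y.
Proof.
have cS : connect_sym coal_adj by exact/sym_connect_sym/coal_sym.
have step a b : union_adj a b ->
    connect coal_adj (\pi_coal_vertex a) (\pi_coal_vertex b).
  move=> ab; apply/connect1/existsP; exists a; apply/existsP; exists b.
  by rewrite !eqxx.
have lift (T : cgraph) (f : T -> G + K) :
    (forall a b, adj a b -> union_adj (f a) (f b)) ->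
    forall a b, connect coal_adj (\pi_coal_vertex (f a)) (\pi_coal_vertex (f b)).
  move=> fP a b; have /connectP[p ap ->] := adj_connected a b.
  elim: p a ap => //= c p IHp a /andP[/fP/step ac /IHp].
  exact: connect_trans.
have base a : connect coal_adj (\pi_coal_vertex (inl u)) (\pi_coal_vertex a).
  case: a => a; first exact: (lift G inl).
  have -> : \pi_coal_vertex (inl u) = \pi_coal_vertex (inr v).
    by apply/eqmodP; rewrite /= /glue /glued !eqxx /= ?orbT.
  exact: (lift K inr).
rewrite -[x]reprK -[y]reprK; apply: connect_trans (base _).
by rewrite cS.
Qed.

Definition coalescence : cgraph := CGraph coal_sym coal_irr coal_connected.

End Coalescence.

Section EdgeList.
Variable s : seq (nat * nat).

Definition edge_adj n : rel 'I_n := fun i j =>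
  ((val i, val j) \in s) || ((val j, val i) \in s).

Lemma edge_adj_sym n : symmetric (@edge_adj n).
Proof. by move=> i j; rewrite /edge_adj orbC. Qed.

Lemma edge_adj_irr n : all (fun e => e.1 != e.2) s -> irreflexive (@edge_adj n).
Proof.
by move=> /allP s_ne i; rewrite /edge_adj orbb; apply/negbTE/negP=> /s_ne/=/eqP.
Qed.

Lemma edge_adj_connected n :
    all (fun i => has (fun e => (e.1 < i) && (e.2 == i)) s) (iota 1 n) ->
  forall i j : 'I_n.+1, connect (@edge_adj n.+1) i j.
Proof.
move=> /allP sP.
have cS : connect_sym (@edge_adj n.+1).
  exact/sym_connect_sym/edge_adj_sym.
have base k : forall i : 'I_n.+1, i = k :> nat -> connect (@edge_adj n.+1) ord0 i.
  elim/ltn_ind: k => k IHk i ik.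
  have [k0|k_gt0] := posnP k.
    by have -> : i = ord0 by apply: val_inj; rewrite /= ik k0.
  have /sP/hasP[[a b] /= abs /andP[ltak /eqP bk]] : k \in iota 1 n.
    by rewrite mem_iota k_gt0 add1n -ik ltn_ord.
  have lta : a < n.+1 by rewrite (ltn_trans ltak) // -ik ltn_ord.
  apply: connect_trans (IHk _ ltak (Ordinal lta) erefl) (connect1 _).
  by rewrite /edge_adj /= ik -bk abs.
by move=> i j; rewrite (connect_trans _ (base _ j erefl)) // cS (base _ i erefl).
Qed.

End EdgeList.

Definition edgesG : seq (nat * nat) :=
  [:: (0, 1); (0, 2); (0, 3); (0, 5); (1, 5); (1, 7); (2, 3); (2, 4); (2, 6);
      (2, 9); (3, 4); (3, 5); (3, 6); (4, 9); (5, 7); (5, 8); (6, 9)].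

Definition edgesH : seq (nat * nat) :=
  [:: (0, 1); (0, 2); (0, 3); (0, 5); (1, 5); (1, 7); (2, 3); (2, 4); (2, 5);
      (2, 6); (2, 9); (3, 8); (4, 9); (5, 8); (6, 9); (7, 8)].

Definition graphG : cgraph :=
  CGraph (@edge_adj_sym edgesG 10) (@edge_adj_irr edgesG 10 isT)
         (@edge_adj_connected edgesG 9 isT).

Definition graphH : cgraph :=
  CGraph (@edge_adj_sym edgesH 10) (@edge_adj_irr edgesH 10 isT)
         (@edge_adj_connected edgesH 9 isT).

(* Main.v *)
(** A vertex of the coalescence of [G] and [K] is a pair (g, k) with [g = u] or
    [k = v], and the distance from (g, k) to (g', k') is d(g, g') + d(k, k').
    There is an orthogonal rational matrix [Q] with row and column sums 1 that
    intertwines the distance matrices of [G] and [H] and fixes the basis vectors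
    of both vertices 0 and 1.  Since it fixes the basis vector of [u], letting
    [Q] act on the first coordinate and the identity on the second defines an
    orthogonal matrix on the coalescences.  It intertwines the parts d(g, g')
    because [Q] does, and the parts d(k, k') because of the row and column
    sums.  *)

Require Import Defs.
From mathcomp Require Import all_boot all_order all_algebra all_field.

Set Implicit Arguments.
Unset Strict Implicit.
Unset Printing Implicit Defensive.

Import GRing.Theory Num.Theory.
Local Open Scope quotient_scope.

(** * Walks and a local characterisation of graph distance *)

Section DistanceTheory.
Variable G : cgraph.

(** [dist] minimises over duplicate-free paths only. Shortening a walk to such a path does not
    lengthen it, so arbitrary walks also give upper bounds. *)
Lemma dist_le_path (x y : G) p :
  path (@adj G) x p -> last x p = y -> dist x y <= size p.
Proof.
move=> xp <-; case/shortenP: xp => q xq uq /(uniq_leq_size (proj2 (andP uq))) szq.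
apply: leq_trans szq; rewrite /dist; case: ex_minnP => m _; apply.
by apply/existsP; exists (in_tuple q); rewrite xq uq eqxx.
Qed.

Lemma dist_path (x y : G) :
  exists p, [/\ path (@adj G) x p, last x p = y & size p = dist x y].
Proof.
rewrite /dist; case: ex_minnP => m /existsP[p /and3P[xp /eqP px _]] _.
by exists p; rewrite size_tuple.
Qed.

Lemma dist_xx (x : G) : dist x x = 0.
Proof. by apply/eqP; rewrite -leqn0 (@dist_le_path x x [::]). Qed.

Lemma dist_adj (x y z : G) : adj y z -> dist x z <= (dist x y).+1.
Proof.
move=> yz; have [p [xp px <-]] := dist_path x y.
rewrite -(size_rcons p z); apply: dist_le_path; last by rewrite last_rcons.
by rewrite rcons_path xp px.
Qed.

Lemma dist_pred (x y : G) :
  y != x -> exists2 z, adj z y & dist x z < dist x y.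
Proof.
move=> yx; have [p [xp px sp]] := dist_path x y.
case: (lastP p) xp px sp => [_ /= xy|q z]; first by rewrite xy eqxx in yx.
rewrite rcons_path last_rcons size_rcons => /andP[xq qz] <- <-.
by exists (last x q) => //; rewrite ltnS; apply: dist_le_path.
Qed.

(** Descending from [y] through neighbours of smaller [d] reaches [x] in at most [d y] steps, while
    [d] grows by at most one per edge of a shortest path from [x]. Both the coalescence formula and
    the distance tables are obtained from this local criterion. *)
Lemma dist_unique (x : G) (d : G -> nat) :
    d x = 0 -> (forall y z, adj y z -> d z <= (d y).+1) ->
    (forall y, y != x -> exists2 z, adj z y & d z < d y) ->
  forall y, dist x y = d y.
Proof.
move=> dx d_adj d_pred y; apply/eqP; rewrite eqn_leq; apply/andP; split.
  have [n] := ubnP (d y); elim: n y => // n IHn y; rewrite ltnS => dy.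
  have [->|/d_pred[z zy dz]] := eqVneq y x; first by rewrite dist_xx.
  apply: leq_trans (dist_adj x zy) _.
  exact: leq_ltn_trans (IHn z (leq_trans dz dy)) dz.
have [p [xp <- <-]] := dist_path x y.
elim/last_ind: p xp => [|p z IHp]; first by rewrite /= dx.
rewrite rcons_path last_rcons size_rcons => /andP[/IHp dp /d_adj dz].
exact: leq_trans dz _.
Qed.

End DistanceTheory.

(** * Coordinates and distances in a coalescence *)

Section CoalescenceDistance.
Variables (G K : cgraph) (u : G) (v : K).

Notation coal := (coalescence u v).

Definition coal_inl (g : G) : coal := \pi_(coal_vertex u v) (inl g).
Definition coal_inr (k : K) : coal := \pi_(coal_vertex u v) (inr k).

(** With the defaults [u] here and [v] in [coal_snd], the glued vertex has coordinates (u, v)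
    whether [repr] picks [inl u] or [inr v]. *)
Definition coal_fst (x : coal) : G :=
  if repr (x : coal_vertex u v) is inl g then g else u.
Definition coal_snd (x : coal) : K :=
  if repr (x : coal_vertex u v) is inr k then k else v.

Lemma coal_inlr : coal_inl u = coal_inr v.
Proof. by apply/eqmodP; rewrite /= /glue /glued !eqxx. Qed.

Lemma repr_pi (a : G + K) : glue u v (repr (\pi_(coal_vertex u v) a)) a.
Proof. by apply/eqmodP; rewrite reprK. Qed.

Lemma coal_fst_inl g : coal_fst (coal_inl g) = g.
Proof.
rewrite /coal_fst /coal_inl; move: (repr_pi (inl g)); rewrite /glue /glued.
by case: (repr _) => a /orP[/eqP|/andP[/orP[]/eqP + /orP[]/eqP]];
  congruence.
Qed.

Lemma coal_fst_inr k : coal_fst (coal_inr k) = u.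
Proof.
rewrite /coal_fst /coal_inr; move: (repr_pi (inr k)); rewrite /glue /glued.
by case: (repr _) => a /orP[/eqP|/andP[/orP[]/eqP + /orP[]/eqP]];
  congruence.
Qed.

Lemma coal_snd_inl g : coal_snd (coal_inl g) = v.
Proof.
rewrite /coal_snd /coal_inl; move: (repr_pi (inl g)); rewrite /glue /glued.
by case: (repr _) => a /orP[/eqP|/andP[/orP[]/eqP + /orP[]/eqP]];
  congruence.
Qed.

Lemma coal_snd_inr k : coal_snd (coal_inr k) = k.
Proof.
rewrite /coal_snd /coal_inr; move: (repr_pi (inr k)); rewrite /glue /glued.
by case: (repr _) => a /orP[/eqP|/andP[/orP[]/eqP + /orP[]/eqP]];
  congruence.
Qed.

Lemma coalP (x : coal) : x = coal_inl (coal_fst x) \/ x = coal_inr (coal_snd x).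
Proof.
rewrite /coal_inl /coal_inr /coal_fst /coal_snd.
by case: (repr _) (reprK (x : coal_vertex u v)) => a <-; [left|right].
Qed.

Lemma coal_inl_fst (x : coal) : coal_snd x = v -> coal_inl (coal_fst x) = x.
Proof.
case: (coalP x) => ->; first by rewrite coal_fst_inl.
by rewrite coal_snd_inr coal_fst_inr => ->; rewrite coal_inlr.
Qed.

Lemma coal_inr_snd (x : coal) : coal_fst x = u -> coal_inr (coal_snd x) = x.
Proof.
case: (coalP x) => ->; last by rewrite coal_snd_inr.
by rewrite coal_fst_inl coal_snd_inl => ->; rewrite coal_inlr.
Qed.

Lemma coal_fst_or_snd (x : coal) : coal_fst x = u \/ coal_snd x = v.
Proof.
by case: (coalP x) => ->;
  [right; rewrite coal_snd_inl|left; rewrite coal_fst_inr].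
Qed.

Lemma coal_pair_inj (x y : coal) :
  coal_fst x = coal_fst y -> coal_snd x = coal_snd y -> x = y.
Proof.
move=> e1 e2; case: (coal_fst_or_snd x) => ex.
  by rewrite -(coal_inr_snd ex) e2 coal_inr_snd // -e1.
by rewrite -(coal_inl_fst ex) e1 coal_inl_fst // -e2.
Qed.

Lemma adj_inl (a b : G) : adj a b -> adj (coal_inl a) (coal_inl b).
Proof.
by move=> ab; apply/existsP; exists (inl a); apply/existsP; exists (inl b);
  rewrite !eqxx.
Qed.

Lemma adj_inr (a b : K) : adj a b -> adj (coal_inr a) (coal_inr b).
Proof.
by move=> ab; apply/existsP; exists (inr a); apply/existsP; exists (inr b);
  rewrite !eqxx.
Qed.

(** The right-hand side satisfies the criterion of [dist_unique]: an edge of the coalescence changes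
    one coordinate, along an edge of [G] or of [K]. *)
Lemma coal_dist (x y : coal) :
  dist x y =
    dist (coal_fst x) (coal_fst y) + dist (coal_snd x) (coal_snd y).
Proof.
apply: (dist_unique (d := fun y => dist (coal_fst x) (coal_fst y) +
  dist (coal_snd x) (coal_snd y))) => {y} [|y z|y yx].
- by rewrite !dist_xx.
- case/existsP=> -[a|a] /existsP[[b|b]] /and3P[/eqP<- /eqP<-] //= ab.
    rewrite -/(coal_inl a) -/(coal_inl b) !coal_fst_inl !coal_snd_inl -addSn.
    by rewrite leq_add2r dist_adj.
  rewrite -/(coal_inr a) -/(coal_inr b) !coal_fst_inr !coal_snd_inr -addnS.
  by rewrite leq_add2l dist_adj.
have in_G : coal_snd y = v -> coal_fst y != coal_fst x ->
  exists2 z : coal, adj z y &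
    dist (coal_fst x) (coal_fst z) + dist (coal_snd x) (coal_snd z) <
    dist (coal_fst x) (coal_fst y) + dist (coal_snd x) (coal_snd y).
  move=> yv /dist_pred[z zy ltz]; exists (coal_inl z).
    by rewrite -(coal_inl_fst yv) adj_inl.
  by rewrite coal_fst_inl coal_snd_inl yv ltn_add2r.
have in_K : coal_fst y = u -> coal_snd y != coal_snd x ->
  exists2 z : coal, adj z y &
    dist (coal_fst x) (coal_fst z) + dist (coal_snd x) (coal_snd z) <
    dist (coal_fst x) (coal_fst y) + dist (coal_snd x) (coal_snd y).
  move=> yu /dist_pred[z zy ltz]; exists (coal_inr z).
    by rewrite -(coal_inr_snd yu) adj_inr.
  by rewrite coal_fst_inr coal_snd_inr yu ltn_add2l.
(* The step towards [x] must be in a coordinate where [x] and [y] differ and in which [y] can move.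
   If [y] has second coordinate [v] and already agrees with [x] in the first, or the symmetric case
   holds, then [coal_fst_or_snd x] forces either [x = y] or that [y] is the glued vertex, which can
   move in both coordinates. *)
have [e1|n1] := eqVneq (coal_fst y) (coal_fst x).
  have n2 : coal_snd y != coal_snd x.
    by apply: contraNneq yx => e2; apply/eqP/coal_pair_inj.
  case: (coal_fst_or_snd y) => ey; first exact: in_K.
  case: (coal_fst_or_snd x) => ex; first by apply: in_K; rewrite ?e1.
  by rewrite ex ey eqxx in n2.
case: (coal_fst_or_snd y) => ey; last exact: in_G.
have [e2|n2] := eqVneq (coal_snd y) (coal_snd x); last exact: in_K.
case: (coal_fst_or_snd x) => ex; first by rewrite ex ey eqxx in n1.
by apply: in_G; rewrite ?e2.
Qed.

End CoalescenceDistance.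
Arguments coal_fst {G K u v} x.
Arguments coal_snd {G K u v} x.

(** * Similarity, and lifting an orthogonal intertwiner to coalescences *)

Local Open Scope ring_scope.

(** The sizes are kept apart because the two coalescences have different vertex types; the two
    inverse equations force [m = n]. *)
Lemma char_poly_similar (R : comUnitRingType) m n
    (P : 'M[R]_(m, n)) (Q : 'M[R]_(n, m)) A B :
    P *m Q = 1%:M -> Q *m P = 1%:M -> A *m P = P *m B ->
  char_poly A = char_poly B.
Proof.
move=> PQ QP AP; have emn : m = n.
  by apply/eqP; rewrite eqn_leq (mulmx1_min PQ) (mulmx1_min QP).
case: _ / emn in P Q B PQ QP AP *.
have -> : A = P *m B *m Q by rewrite -AP -mulmxA PQ mulmx1.
pose pc := map_mx (@polyC R).
have pcPQ : pc _ _ P *m pc _ _ Q = 1%:M by rewrite -map_mxM PQ map_mx1.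
rewrite /char_poly; have -> : char_poly_mx (P *m B *m Q) =
    pc _ _ P *m char_poly_mx B *m pc _ _ Q.
  rewrite /char_poly_mx mulmxBr mulmxBl -!map_mxM; congr (_ - _).
  by rewrite scalar_mxC -mulmxA pcPQ mulmx1.
by rewrite !det_mulmx mulrAC -det_mulmx pcPQ det1 mul1r.
Qed.

Section CoalescenceOperator.
Variables (G H K : cgraph) (u : G) (w : H) (v : K) (Q : G -> H -> algC).

Definition coal_op (x : coalescence u v) (y : coalescence w v) : algC :=
  Q (coal_fst x) (coal_fst y) * (coal_snd x == coal_snd y)%:R.

(** Only the [z] with the same second coordinate as [x] contribute. If that coordinate is [v], they
    form the copy of [H]. Otherwise [x] has first coordinate [u] and the only such [z] is (w,
    coal_snd x); the right-hand sum collapses to the same term because row [u] of [Q] is the basis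
    vector of [w]. *)
Lemma coal_op_sum x (F : H -> K -> algC) :
    (forall h, Q u h = (h == w)%:R) ->
  \sum_z coal_op x z * F (coal_fst z) (coal_snd z) =
  \sum_h Q (coal_fst x) h * F h (coal_snd x).
Proof.
move=> row_u.
transitivity (\sum_(z : coalescence w v | coal_snd z == coal_snd x)
    Q (coal_fst x) (coal_fst z) * F (coal_fst z) (coal_snd x)).
  rewrite [RHS]big_mkcond; apply: eq_bigr => z _; rewrite /coal_op eq_sym.
  by case: eqP => [->|_]; rewrite ?mulr1 // mulr0 mul0r.
have [xv|xv] := eqVneq (coal_snd x) v.
  rewrite xv (reindex_onto (@coal_inl H K w v) coal_fst) /=; last first.
    by move=> z /eqP; apply: coal_inl_fst.
  by apply: eq_big => h; rewrite coal_fst_inl // coal_snd_inl !eqxx.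
have xu : coal_fst x = u.
  by case: (coal_fst_or_snd x) xv => // ->; rewrite eqxx.
rewrite (big_pred1 (coal_inr w v (coal_snd x))) => [|z].
  rewrite coal_fst_inr xu row_u eqxx mul1r (bigD1 w) //= row_u eqxx mul1r.
  by rewrite big1 ?addr0 // => h /negPf hw; rewrite row_u hw mul0r.
apply/eqP/eqP => [zx|->]; last by rewrite coal_snd_inr.
apply: coal_pair_inj; rewrite ?coal_fst_inr ?coal_snd_inr //.
by case: (coal_fst_or_snd z) => // zv; rewrite -zx zv eqxx in xv.
Qed.

End CoalescenceOperator.

(** Column statements follow from row statements with the two graphs exchanged. *)
Lemma coal_op_trmx (G H K : cgraph) (u : G) (w : H) (v : K) (Q : G -> H -> algC)
    (x : coalescence u v) (y : coalescence w v) :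
  coal_op Q x y = coal_op (fun h g => Q g h) y x.
Proof. by rewrite /coal_op eq_sym. Qed.

Lemma coal_op_orth (G H K : cgraph) (u : G) (w : H) (v : K) (Q : G -> H -> algC)
    (x y : coalescence u v) :
    (forall h, Q u h = (h == w)%:R) ->
    (forall g g', \sum_h Q g h * Q g' h = (g == g')%:R) ->
  \sum_(z : coalescence w v) coal_op Q x z * coal_op Q y z = (x == y)%:R.
Proof.
move=> row_u orth; rewrite (coal_op_sum x
  (fun h k => Q (coal_fst y) h * (coal_snd y == k)%:R) row_u).
under eq_bigr do rewrite mulrA; rewrite -mulr_suml orth -natrM mulnb.
congr (nat_of_bool _)%:R; apply/andP/eqP => [[/eqP e1 /eqP e2]|->//].
exact: coal_pair_inj.
Qed.

Lemma coalescence_cospectral (G H K : cgraph) (u : G) (w : H) (v : K)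
    (Q : G -> H -> algC) :
    (forall h, Q u h = (h == w)%:R) -> (forall g, Q g w = (g == u)%:R) ->
    (forall g, \sum_h Q g h = 1) -> (forall h, \sum_g Q g h = 1) ->
    (forall g g', \sum_h Q g h * Q g' h = (g == g')%:R) ->
    (forall h h', \sum_g Q g h * Q g h' = (h == h')%:R) ->
    (forall g h, \sum_g' (dist g g')%:R * Q g' h =
                 \sum_h' Q g h' * (dist h' h)%:R) ->
  distance_cospectral (coalescence u v) (coalescence w v).
Proof.
move=> row_u col_w sum_row sum_col orth_row orth_col QD.
pose P := \matrix_(i < #|{: coalescence u v}|, j < #|{: coalescence w v}|)
  coal_op Q (enum_val i) (enum_val j).
(* [spectrum] depends on the characteristic polynomial alone, so equal polynomials give the same
   list. *)
rewrite /distance_cospectral /spectrum (char_poly_similar (P := P) (Q := P^T)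
  (B := distance_mx (coalescence w v))) //.
- apply/matrixP => i j; rewrite !mxE -(inj_eq enum_val_inj).
  rewrite -(coal_op_orth _ _ row_u orth_row) [RHS]big_enum_val.
  by apply: eq_bigr => k _; rewrite !mxE.
- apply/matrixP => i j; rewrite !mxE -(inj_eq enum_val_inj).
  rewrite -(coal_op_orth (w := u) (Q := fun h g => Q g h) _ _ col_w orth_col).
  rewrite [RHS]big_enum_val.
  by apply: eq_bigr => k _; rewrite !mxE !(coal_op_trmx Q).
apply/matrixP => i j; rewrite !mxE.
set x := enum_val i; set y := enum_val j.
transitivity (\sum_(z : coalescence u v) coal_op (fun h g => Q g h) y z *
    ((dist (coal_fst x) (coal_fst z))%:R + (dist (coal_snd x) (coal_snd z))%:R)).
  rewrite [RHS]big_enum_val; apply: eq_bigr => k _; rewrite !mxE -/x -/y.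
  by rewrite mulrC coal_dist natrD coal_op_trmx.
rewrite (coal_op_sum y (fun g k => (dist (coal_fst x) g)%:R +
  (dist (coal_snd x) k)%:R) col_w).
transitivity (\sum_(z : coalescence w v) coal_op Q x z *
    ((dist (coal_fst z) (coal_fst y))%:R + (dist (coal_snd z) (coal_snd y))%:R)).
  rewrite (coal_op_sum x (fun h k => (dist h (coal_fst y))%:R +
    (dist k (coal_snd y))%:R) row_u).
  (* The distance in [K] is constant in both sums, so unit column and row sums leave the same term
     on each side; [QD] matches the remaining parts. *)
  under eq_bigr do rewrite mulrDr; under [RHS]eq_bigr do rewrite mulrDr.
  rewrite !big_split -!mulr_suml sum_row sum_col /= -QD.
  by congr (_ + _); apply: eq_bigr => g _; rewrite mulrC.
rewrite big_enum_val; apply: eq_bigr => k _; rewrite !mxE -/x -/y.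
by rewrite coal_dist natrD.
Qed.

(** * Distance tables and the integer matrix for the two concrete graphs *)

Definition distG : seq (seq nat) :=
[:: [:: 0; 1; 1; 1; 2; 1; 2; 2; 2; 2]; [:: 1; 0; 2; 2; 3; 1; 3; 1; 2; 3];
    [:: 1; 2; 0; 1; 1; 2; 1; 3; 3; 1]; [:: 1; 2; 1; 0; 1; 1; 1; 2; 2; 2];
    [:: 2; 3; 1; 1; 0; 2; 2; 3; 3; 1]; [:: 1; 1; 2; 1; 2; 0; 2; 1; 1; 3];
    [:: 2; 3; 1; 1; 2; 2; 0; 3; 3; 1]; [:: 2; 1; 3; 2; 3; 1; 3; 0; 2; 4];
    [:: 2; 2; 3; 2; 3; 1; 3; 2; 0; 4]; [:: 2; 3; 1; 2; 1; 3; 1; 4; 4; 0]]%N.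

Definition distH : seq (seq nat) :=
[:: [:: 0; 1; 1; 1; 2; 1; 2; 2; 2; 2]; [:: 1; 0; 2; 2; 3; 1; 3; 1; 2; 3];
    [:: 1; 2; 0; 1; 1; 1; 1; 3; 2; 1]; [:: 1; 2; 1; 0; 2; 2; 2; 2; 1; 2];
    [:: 2; 3; 1; 2; 0; 2; 2; 4; 3; 1]; [:: 1; 1; 1; 2; 2; 0; 2; 2; 1; 2];
    [:: 2; 3; 1; 2; 2; 2; 0; 4; 3; 1]; [:: 2; 1; 3; 2; 4; 2; 4; 0; 1; 4];
    [:: 2; 2; 2; 1; 3; 1; 3; 1; 0; 3]; [:: 2; 3; 1; 2; 1; 2; 1; 4; 3; 0]]%N.

(* 7 Q, where the linear conditions D_G Q = Q D_H, Q 1 = 1, Q^T 1 = 1 and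
   Q e_i = Q^T e_i = e_i for i = 0, 1 leave a one-parameter family of matrices,
   in which orthogonality is a quadratic equation with two rational roots. *)
Definition intertwiner7 : seq (seq int) :=
[:: [:: 7; 0; 0; 0; 0; 0; 0; 0; 0; 0]; [:: 0; 7; 0; 0; 0; 0; 0; 0; 0; 0];
    [:: 0; 0; 5; 1; 2; 1; 2; 1; -3; -2]; [:: 0; 0; -1; 4; 1; 4; 1; -3; 2; -1];
    [:: 0; 0; 2; -1; 5; -1; -2; -1; 3; 2]; [:: 0; 0; 3; 2; -3; 2; -3; 2; 1; 3];
    [:: 0; 0; 2; -1; -2; -1; 5; -1; 3; 2]; [:: 0; 0; -1; -3; 1; 4; 1; 4; 2; -1];
    [:: 0; 0; -1; 4; 1; -3; 1; 4; 2; -1]; [:: 0; 0; -2; 1; 2; 1; 2; 1; -3; 5]].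

Definition entry (T : nmodType) (s : seq (seq T)) (i j : nat) : T :=
  nth 0 (nth [::] s i) j.

Lemma forall_ord2 n (p : nat -> nat -> bool) :
    all (fun i => all (p i) (iota 0 n)) (iota 0 n) ->
  forall i j : 'I_n, p i j.
Proof.
by move=> /allP pP i j; have /pP/allP -> : val i \in iota 0 n;
  rewrite ?mem_iota ?ltn_ord.
Qed.

(** Replaces the locked big operator by a form that [vm_compute] can evaluate. *)
Lemma sum_ord_foldr (V : nmodType) n (F : nat -> V) :
  \sum_(i < n) F i = foldr (fun i s => F i + s) 0 (iota 0 n).
Proof. by rewrite -(big_mkord xpredT) /index_iota subn0 unlock. Qed.

(** The boolean test spells out the hypotheses of [dist_unique] for each source [i], so a table is
    certified without searching for shortest paths. *)
Lemma dist_edge_adj (s : seq (nat * nat)) n (d : nat -> nat -> nat) sym irr conn :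
    all (fun i => (d i i == 0)%N && all (fun j =>
      all (fun k => ((j, k) \in s) || ((k, j) \in s) ==> (d i k <= (d i j).+1)%N)
        (iota 0 n) &&
      ((j == i) || has (fun k => (((k, j) \in s) || ((j, k) \in s)) &&
        (d i k < d i j)%N) (iota 0 n)))
      (iota 0 n)) (iota 0 n) ->
  forall i j : 'I_n,
    dist (i : @CGraph 'I_n (@edge_adj s n) sym irr conn) j = d i j.
Proof.
move=> /allP dP i j.
have iotaP (k : 'I_n) : val k \in iota 0 n by rewrite mem_iota ltn_ord.
have /andP[/eqP d0 /allP {}dP] := dP _ (iotaP i).
apply: (@dist_unique (CGraph sym irr conn) i (fun j : 'I_n => d i j)) => // [k l|k].
  by have /andP[/allP/(_ _ (iotaP l))/implyP d_adj _] := dP _ (iotaP k).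
have /andP[_ /predU1P[/val_inj->|]] := dP _ (iotaP k); first by rewrite eqxx.
case/hasP=> l; rewrite mem_iota => /= ltln /andP[lk ltd] _.
by exists (Ordinal ltln).
Qed.

Lemma dist_graphG (i j : graphG) : dist i j = entry distG i j.
Proof. by apply: (dist_edge_adj (d := entry distG)); vm_compute. Qed.

Lemma dist_graphH (i j : graphH) : dist i j = entry distH i j.
Proof. by apply: (dist_edge_adj (d := entry distH)); vm_compute. Qed.

(** * Verification of the rational intertwiner by integer computation *)

Definition intertwiner (g : graphG) (h : graphH) : algC :=
  (entry intertwiner7 g h)%:~R / 7.

Lemma intertwiner_fixed (u : 'I_10) : u = 0%N :> nat \/ u = 1%N :> nat ->
  (forall h : graphH, intertwiner u h = (h == u)%:R) /\
  (forall g : graphG, intertwiner g u = (g == u)%:R).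
Proof.
have rowP (i j : 'I_10) : ((i < 2) || (j < 2))%N ->
    entry intertwiner7 i j = ((i == j :> nat) * 7)%:Z.
  move=> ij; apply/eqP; move: ij; apply/implyP; move: i j.
  by apply: (@forall_ord2 10 (fun i j => ((i < 2) || (j < 2))%N ==>
    (entry intertwiner7 i j == ((i == j) * 7)%:Z))); vm_compute.
have seven : (7 : algC) != 0 by rewrite pnatr_eq0.
move=> u01; have ltu : (u < 2)%N by case: u01 => ->.
by split=> g; rewrite /intertwiner rowP ?ltu ?orbT // -pmulrn natrM mulfK // eq_sym.
Qed.

Lemma sum_intr_foldr n (F : nat -> int) :
  \sum_(i < n) (F i)%:~R = (foldr (fun i s => F i + s) 0 (iota 0 n))%:~R :> algC.
Proof. by rewrite -rmorph_sum sum_ord_foldr. Qed.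

Local Notation N := (entry intertwiner7).

Lemma intertwiner_sum_row g : \sum_h intertwiner g h = 1.
Proof.
rewrite -mulr_suml (sum_intr_foldr 10 (N g)).
rewrite [foldr _ _ _](_ : _ = 7) ?divff ?pnatr_eq0 //; apply/eqP.
(* A one-index check: [forall_ord2] is applied on the diagonal with a dummy second index. *)
by apply: (@forall_ord2 10 (fun g _ => foldr (fun h s => N g h + s) 0
  (iota 0 10) == 7) _ g g); vm_compute.
Qed.

Lemma intertwiner_sum_col h : \sum_g intertwiner g h = 1.
Proof.
rewrite -mulr_suml (sum_intr_foldr 10 (N^~ h)).
rewrite [foldr _ _ _](_ : _ = 7) ?divff ?pnatr_eq0 //; apply/eqP.
by apply: (@forall_ord2 10 (fun h _ => foldr (fun g s => N g h + s) 0
  (iota 0 10) == 7) _ h h); vm_compute.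
Qed.

(** Orthonormality of the rows or columns of the intertwiner becomes an integer identity with 49,
    the product of the two denominators 7. *)
Lemma scaled_delta (b : bool) : ((b * 49)%:Z)%:~R * (7^-1 * 7^-1) = b%:R :> algC.
Proof. by rewrite -invfM -natrM -pmulrn (natrM _ b) mulfK ?pnatr_eq0. Qed.

Lemma intertwiner_orth_row g g' :
  \sum_h intertwiner g h * intertwiner g' h = (g == g')%:R.
Proof.
under eq_bigr do rewrite mulrACA -intrM.
rewrite -mulr_suml (sum_intr_foldr 10 (fun h => N g h * N g' h)) -scaled_delta.
congr (_%:~R * _); apply/eqP.
by apply: (@forall_ord2 10 (fun g g' => foldr (fun h s => N g h * N g' h + s) 0
  (iota 0 10) == ((g == g') * 49)%:Z)); vm_compute.
Qed.

Lemma intertwiner_orth_col h h' :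
  \sum_g intertwiner g h * intertwiner g h' = (h == h')%:R.
Proof.
under eq_bigr do rewrite mulrACA -intrM.
rewrite -mulr_suml (sum_intr_foldr 10 (fun g => N g h * N g h')) -scaled_delta.
congr (_%:~R * _); apply/eqP.
by apply: (@forall_ord2 10 (fun h h' => foldr (fun g s => N g h * N g h' + s) 0
  (iota 0 10) == ((h == h') * 49)%:Z)); vm_compute.
Qed.

Lemma intertwiner_dist (g : graphG) (h : graphH) :
  \sum_g' (dist g g')%:R * intertwiner g' h =
  \sum_h' intertwiner g h' * (dist h' h)%:R.
Proof.
under eq_bigr do rewrite dist_graphG mulrA [_%:R]pmulrn -intrM.
under [RHS]eq_bigr do rewrite dist_graphH mulrAC [_%:R]pmulrn -intrM.
(* Both sides carry the same factor [7^-1], which leaves an identity between integer matrix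
   products. *)
rewrite -!mulr_suml.
rewrite (sum_intr_foldr 10 (fun g' => (entry distG g g')%:Z * N g' h)).
rewrite (sum_intr_foldr 10 (fun h' => N g h' * (entry distH h' h)%:Z)).
congr (_%:~R * _); apply/eqP; apply: (@forall_ord2 10 (fun g h =>
  foldr (fun g' s => (entry distG g g')%:Z * N g' h + s) 0 (iota 0 10) ==
  foldr (fun h' s => N g h' * (entry distH h' h)%:Z + s) 0 (iota 0 10))).
by vm_compute.
Qed.

Local Close Scope ring_scope.

Theorem theorem1 (K : cgraph) (v : K) (u : 'I_10)
    (hu : u = 0 :> nat \/ u = 1 :> nat) :
  distance_cospectral (coalescence (u : graphG) v) (coalescence (u : graphH) v).
Proof.
have [row_u col_u] := intertwiner_fixed hu.
exact: (coalescence_cospectral v row_u col_u intertwiner_sum_row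
  intertwiner_sum_col intertwiner_orth_row intertwiner_orth_col intertwiner_dist).
Qed.
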